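(* Fix a state $q\in\mathbb{Z}_+^{\mathcal I}$ and two distinct queues $\mu,\nu\in\mathcal I$ that can be served simultaneously, i.e. $e_\mu+e_\nu\in\mathcal P$. For $n\ge 0$, say that serving $\mu$ and $\nu$ is an optimal action on a state $p$ in the $n$-th iteration if the schedule $e_\mu+e_\nu$ attains the maximum $$\max_{s\in\mathcal P}\left\{ r(p,s)+\beta\,\mathbb{E}\big[V_n((p-s)^++A)\big]\right\}.$$ Then, for every $n\ge 0$: if serving $\mu$ and $\nu$ is an optimal action on $q$ in the $n$-th iteration, then it is an optimal action on $q+e_\mu$ and on $q+e_\nu$ in the $n$-th iteration. Therefore, in that iteration, serving $\mu$ and $\nu$ is an optimal action on every state $q'\in\mathbb{Z}_+^{\mathcal I}$ with $q'_\mu\ge q_\mu$, $q'_\nu\ge q_\nu$, and $q'_\rho=q_\rho$ for all $\rho\in\mathcal I$ such that $\rho\#\mu$.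
   Context: Let $\mathcal I=\{(i,j): i,j\in\{1,2\}\}$ index the four queues of a $2\times 2$ input-queued switch (queue $(i,j)$ is for input port $i$ and output port $j$). States are vectors $q=(q_\rho)_{\rho\in\mathcal I}\in\mathbb{Z}_+^{\mathcal I}\cong\mathbb{Z}_+^4$, $\mathbb{Z}_+=\{0,1,2,\dots\}$. A schedule is a vector $s=(s_\rho)_{\rho\in\mathcal I}\in\{0,1\}^{\mathcal I}$ with $\sum_j s_{(i,j)}\le 1$ for each $i$ and $\sum_i s_{(i,j)}\le 1$ for each $j$; $\mathcal P$ is the set of all schedules. The arrival vector $A=(A_\rho)_{\rho\in\mathcal I}$ takes values in $\mathbb{Z}_+^{\mathcal I}$, has independent coordinates, and its means $\lambda_\rho=\mathbb{E}[A_\rho]$ satisfy $\sum_i\lambda_{(i,j)}<1$ for each $j$ and $\sum_j\lambda_{(i,j)}<1$ for each $i$. Fix cost constants $c_\rho\ge 0$ ($\rho\in\mathcal I$) and $\beta\in(0,1)$. The reward is $r(q,s)=\sum_{\rho\in\mathcal I}c_\rho s_\rho\,\mathbb{I}_{\{q_\rho>0\}}$. Write $(x)^+$ for the componentwise maximum of $x$ and $0$. The value functions of value iteration are $V_0\equiv 0$ and $V_{n+1}(q)=\max_{s\in\mathcal P}\{r(q,s)+\beta\,\mathbb{E}[V_n((q-s)^++A)]\}$ for $n\ge 0$. $e_\rho$ denotes the unit vector of $\mathbb{Z}_+^{\mathcal I}$ with a single $1$ in coordinate $\rho$. For two distinct queues, $\rho\#\mu$ means that $\rho$ and $\mu$ cannot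 both be contained in a schedule (they share an input or an output port). *)

(* Defs.v *)
From HB Require Import structures.
From mathcomp Require Import all_boot all_order all_algebra.
From mathcomp Require Import all_classical all_reals all_analysis.

Set Implicit Arguments.
Unset Strict Implicit.
Unset Printing Implicit Defensive.

Import Order.TTheory GRing.Theory Num.Theory.

Local Open Scope ring_scope.

(* The queue (i, j) holds the jobs going from input port i to output port j. *)
Definition queue : finType := ('I_2 * 'I_2)%type.

(* Addition of states is the pointwise one of the nmodType {ffun queue -> nat}. *)
Definition state : Type := {ffun queue -> nat}.

Definition unit_state (rho : queue) : state := [ffun p => (p == rho : nat)].

(* (q - s)^+ : subtraction on nat is truncated at 0. *)
Definition serve (q s : state) : state := [ffun rho => (q rho - s rho)%N].

Definition is_schedule (s : state) : bool :=
  [&& [forall rho, (s rho <= 1)%N],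
      [forall i : 'I_2, (\sum_(j < 2) s (i, j) <= 1)%N] &
      [forall j : 'I_2, (\sum_(i < 2) s (i, j) <= 1)%N]].

(* The type state is infinite, so the finite set of schedules is listed by
   filtering the 0-1 vectors; see mem_schedules. *)
Definition schedules : seq state :=
  [seq s <- [seq [ffun rho => (b rho : nat)] | b : {ffun queue -> bool}]
   | is_schedule s].

Lemma mem_schedules (s : state) : (s \in schedules) = is_schedule s.
Proof.
rewrite mem_filter andb_idr// => /and3P[/forallP s01 _ _].
apply/fintype.imageP; exists [ffun rho => s rho == 1%N] => //.
apply/ffunP => rho; rewrite !ffunE.
by case: (s rho) (s01 rho) => [|[|]].
Qed.

Definition conflict (rho mu : queue) : Prop :=
  rho <> mu /\ forall s : state, s \in schedules -> ~ (s rho = 1%N /\ s mu = 1%N).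

Lemma conflictE (rho mu : queue) :
  conflict rho mu <-> rho <> mu /\ (rho.1 = mu.1 \/ rho.2 = mu.2).
Proof.
split=> -[rhoNmu H]; split=> //; last first.
  move=> s; rewrite mem_schedules => /and3P[_ /forallP rows /forallP cols] [].
  case: rho mu rhoNmu H => [i j] [k l] /= ne [eik | ejl] s1 s2.
    have jl : l != j by apply/eqP => e; apply: ne; rewrite eik e.
    have := rows i; rewrite (bigD1 j)//= (bigD1 l)//= s1.
    by rewrite {1}eik s2.
  have ik : k != i by apply/eqP => e; apply: ne; rewrite ejl e.
  have := cols j; rewrite (bigD1 i)//= (bigD1 k)//= s1.
  by rewrite {1}ejl s2.
apply: contrapT => /not_orP[n1 n2].
apply: (H (unit_state rho + unit_state mu)); last first.
  have ne : (rho == mu) = false by apply/eqP.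
  by rewrite !ffunE !eqxx ne eq_sym ne.
rewrite mem_schedules.
case: rho mu {H rhoNmu} n1 n2 => [i j] [k l] /= /eqP n1 /eqP n2.
apply/and3P; split; apply/forallP => x; last 2 first.
- rewrite !big_ord_recr big_ord0 /= !ffunE !xpair_eqE.
  by move: i k j l x n1 n2 => [[|[|//]] ?] [[|[|//]] ?] [[|[|//]] ?]
    [[|[|//]] ?] [[|[|//]] ?].
- rewrite !big_ord_recr big_ord0 /= !ffunE !xpair_eqE.
  by move: i k j l x n1 n2 => [[|[|//]] ?] [[|[|//]] ?] [[|[|//]] ?]
    [[|[|//]] ?] [[|[|//]] ?].
case: x => [y z]; rewrite !ffunE !xpair_eqE.
by move: i k j l y z n1 n2 => [[|[|//]] ?] [[|[|//]] ?] [[|[|//]] ?]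
  [[|[|//]] ?] [[|[|//]] ?] [[|[|//]] ?].
Qed.

(* Mutual independence: the product rule over every subfamily. *)
Definition mutually_independent d (T : measurableType d) (R : realType)
    (P : probability T R) d' (T' : measurableType d') (I : finType)
    (X : I -> {RV P >-> T'}) : Prop :=
  forall (J : {set I}) (B : I -> set T'), (forall i, measurable (B i)) ->
    P (\bigcap_(i in [set` J]) (X i @^-1` B i))%classic
    = (\prod_(i in J) P (X i @^-1` B i)%classic)%E.

Section value_iteration.
Context d (T : measurableType d) (R : realType) (P : probability T R).
Variables (A : queue -> {RV P >-> nat}) (c : queue -> R) (beta : R).

Definition arrival (w : T) : state := [ffun rho => A rho w].

Definition arrival_mean (rho : queue) : \bar R :=
  ('E_P [fun w => (A rho w)%:R%R])%E.

Definition reward (q s : state) : R :=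
  \sum_(rho : queue) c rho * (s rho)%:R * (0 < q rho)%N%:R.

(* The random variable is bounded when V is, as all value functions are;
   the expectation is then finite and fine loses nothing. *)
Definition action_value (V : state -> R) (q s : state) : R :=
  reward q s + beta * fine ('E_P [fun w => V (serve q s + arrival w)%R])%E.

(* The zero vector is a schedule, so taking its value as the default of the
   iterated maximum does not change the maximum. *)
Definition optimal_value (V : state -> R) (q : state) : R :=
  \big[Num.max/action_value V q 0]_(s <- schedules) action_value V q s.

Fixpoint value (n : nat) : state -> R :=
  if n is n'.+1 then optimal_value (value n') else fun=> 0.

Definition optimal_action (n : nat) (p s : state) : Prop :=
  s \in schedules /\ action_value (value n) p s = optimal_value (value n) p.

End value_iteration.

(* Main.v *)
Require Import Defs.
From mathcomp Require Import all_boot all_order all_algebra.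
From mathcomp Require Import all_classical all_reals all_analysis.
From mathcomp Require Import ring lra zify.

Set Implicit Arguments.
Unset Strict Implicit.
Unset Printing Implicit Defensive.

Import Order.TTheory GRing.Theory Num.Theory.
Import numFieldNormedType.Exports.

Local Open Scope ring_scope.

(** The four queues form a 4-cycle of conflicts, so there are only two maximal
schedules: the matching containing mu and the other one, containing the two
queues that conflict with mu.  Serving more is never worse, because one more
job in a queue kappa raises a value function by at least 0 and at most c kappa
(its reward is collected at most once, possibly discounted).  Hence each
iteration only compares two numbers, and serving the matching of mu is optimal
exactly when its [advantage] over the other matching is nonnegative.  The
theorem follows from the monotonicity of the advantage: it does not decrease
when jobs are added to mu or its partner, nor when jobs are removed from the
two other queues ([advantage_le]).

Write M and N for the two matchings, mu for a queue of M, W for the mean of the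
previous value function after the arrivals, and D W for the increment of W when
a job is added to mu.  If mu is empty, serving M turns an added job into the
full reward c mu, the largest possible increment.  Otherwise the advantage
increases by beta times D W ((q - M)^+) - D W ((q - N)^+), and this is
nonnegative as soon as W has the following properties ([switch_shaped]): D W
increases with the queue of M other than mu, decreases with each queue of N,
and D W (q + M) <= D W (q + N).  Away from the boundary the last property is the
required inequality, because serving M leaves the jobs of N in place and vice
versa; the first two are needed because a service removes only part of its
matching when some of the queues are empty ([incr_matching_mixed]).

These properties pass from W to the maximum of the two action values
([switch_shaped_max]).  Each is an inequality between values at four points;
choose for the two points of the smaller side the schedules that are optimal
there, and assign them suitably to the points of the larger side.  When the two
schedules agree, the inequality holds for the corresponding action value; when
they differ, it is the monotonicity of the advantage, or, for the third
property, the identity (q + M) - M = (q + N) - N, which makes the two relevant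
increments equal; the only remaining combination is excluded by the
monotonicity of the advantage.  The properties also pass to means because they
are linear in the function and invariant under translation; the value functions
are bounded, so all means are finite. *)

(** * Increments of functions on states, and their means after the arrivals *)

Definition bounded_fn (R : realType) (f : state -> R) : Prop :=
  exists M : R, forall q, `|f q| <= M.

Definition incr (R : realType) (f : state -> R) (mu : queue) (q : state) : R :=
  f (q + unit_state mu) - f q.

Lemma bounded_fn_incr (R : realType) (f : state -> R) mu :
  bounded_fn f -> bounded_fn (incr f mu).
Proof.
move=> [M fM]; exists (M + M) => q.
by rewrite (le_trans (ler_normB _ _))// lerD.
Qed.

Section mean_after_arrivals.
Context d (T : measurableType d) (R : realType) (P : probability T R).
Context (A : queue -> {RV P >-> nat}).

Definition mean (f : state -> R) (q : state) : R :=
  fine ('E_P [fun w => f (q + arrival A w)%R])%E.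

(** The event is a countable union, over the possible arrival vectors, of finite
intersections of events on single queues. *)
Lemma measurable_arrival (f : state -> R) (q : state) :
  measurable_fun [set: T] (fun w => f (q + arrival A w)).
Proof.
move=> _ Y mY; rewrite setTI.
(* Requiring Y (f (q + x)) in every component makes F x empty for the arrival
   vectors x with f (q + x) outside Y. *)
pose F (x : state) := (\bigcap_(rho in [set: queue])
  (A rho @^-1` [set n | n = x rho /\ Y (f (q + x))]))%classic.
have -> : ((fun w => f (q + arrival A w)) @^-1` Y = \bigcup_x F x)%classic.
  apply/seteqP; split=> w /= => [Yw|[x _ Fx]].
    by exists (arrival A w) => // rho _ /=; rewrite ffunE.
  have -> : arrival A w = x.
    by apply/ffunP => rho; rewrite ffunE; have [] := Fx rho I.
  by have [] := Fx (ord0, ord0) I.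
apply: countable_bigcupT_measurable => [|x]; first exact: countableP.
apply: fin_bigcap_measurable => [|rho _]; first exact: finite_finset.
by rewrite -[X in measurable X]setTI; apply: measurable_funPT.
Qed.

Lemma integrable_arrival (f : state -> R) (q : state) : bounded_fn f ->
  P.-integrable [set: T] (EFin \o (fun w => f (q + arrival A w))).
Proof.
move=> [M fM]; apply: measurable_bounded_integrable => //.
- by rewrite (le_lt_trans (probability_le1 _ _))// ltry.
- exact: measurable_arrival.
- exists M; split; [exact: num_real|move=> x xM w _].
  by rewrite /= (le_trans (fM _))// ltW.
Qed.

Lemma mean_le (f g : state -> R) (q r : state) : bounded_fn f -> bounded_fn g ->
  (forall x, f (q + x) <= g (r + x)) -> mean f q <= mean g r.
Proof.
move=> bf bg fg; rewrite /mean unlock.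
by apply: le_Rintegral => //; exact: integrable_arrival.
Qed.

Lemma mean_cst (k : R) (q : state) : mean (fun=> k) q = k.
Proof. by rewrite /mean expectation_cst. Qed.

(** Increments commute with the mean, so an inequality between increments is
inherited by the mean. *)
Lemma incr_mean (f : state -> R) (mu : queue) (q : state) : bounded_fn f ->
  incr (mean f) mu q = mean (incr f mu) q.
Proof.
move=> bf; rewrite /incr /mean unlock.
rewrite -RintegralB//; [|exact: integrable_arrival..].
by congr fine; apply: eq_integral => w _; rewrite addrAC.
Qed.

Lemma bounded_fn_mean (f : state -> R) : bounded_fn f -> bounded_fn (mean f).
Proof.
move=> bf; have [M fM] := bf; exists M => q.
have b k : bounded_fn (fun=> k : R) by exists `|k|.
rewrite ler_norml -{1}(mean_cst (- M) q) -{2}(mean_cst M q).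
by apply/andP; split; apply: mean_le => // x; have := fM (q + x);
  rewrite ler_norml => /andP[].
Qed.
End mean_after_arrivals.

(** * The two matchings of the switch *)

Definition mate (mu : queue) : queue := (rev_ord mu.1, rev_ord mu.2).

(** The two maximal schedules are [matching mu] and [matching rho], for any queues
mu and rho that cross. *)
Definition matching (mu : queue) : state := unit_state mu + unit_state (mate mu).

(** The computable form of [conflict]; see [conflict_crosses]. *)
Definition crosses (rho mu : queue) : bool := (rho != mu) && (rho != mate mu).

Lemma mateK : involutive mate.
Proof. by case=> i j; rewrite /mate /= !rev_ordK. Qed.

Lemma matching_mate mu : matching (mate mu) = matching mu.
Proof. by rewrite /matching mateK addrC. Qed.

Lemma mate_neq mu : (mate mu == mu) = false.
Proof. by case: mu => [[[|[|//]] ?] [[|[|//]] ?]]. Qed.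

Lemma neq_mate mu : (mu == mate mu) = false.
Proof. by rewrite eq_sym mate_neq. Qed.

Lemma crossesC rho mu : crosses rho mu = crosses mu rho.
Proof. by rewrite /crosses eq_sym (eq_sym mu (mate rho)) (inv_eq mateK). Qed.

Lemma crosses_mate rho mu : crosses rho (mate mu) = crosses rho mu.
Proof. by rewrite /crosses mateK andbC. Qed.

Lemma mate_crosses rho mu : crosses (mate rho) mu = crosses rho mu.
Proof. by rewrite crossesC crosses_mate crossesC. Qed.

Lemma queue_cases rho mu kappa : crosses rho mu ->
  [|| kappa == mu, kappa == mate mu, kappa == rho | kappa == mate rho].
Proof.
by move: mu rho kappa => [[[|[|//]] ?] [[|[|//]] ?]] [[[|[|//]] ?] [[|[|//]] ?]]
  [[[|[|//]] ?] [[|[|//]] ?]].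
Qed.

Lemma matchingE mu kappa :
  matching mu kappa = ((kappa == mu) || (kappa == mate mu)) :> nat.
Proof.
rewrite !ffunE; case: (eqVneq kappa mu) => // ->.
by rewrite neq_mate.
Qed.

Lemma matching_le1 mu kappa : (matching mu kappa <= 1)%N.
Proof. by rewrite matchingE leq_b1. Qed.

Lemma matching_cross rho mu : crosses rho mu -> matching mu rho = 0.
Proof. by rewrite matchingE => /andP[/negbTE-> /negbTE->]. Qed.

Lemma unit_state_muln mu n kappa :
  (unit_state mu *+ n) kappa = ((kappa == mu) * n)%N.
Proof.
elim: n => [|n IHn]; first by rewrite mulr0n ffunE muln0.
by rewrite mulrS 2!ffunE IHn mulnS.
Qed.

(** An added job is visible after the service, unless it is the one that the
service takes out of an empty queue. *)
Lemma serve_unit (q s : state) (mu : queue) : (s mu <= 1)%N ->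
  serve (q + unit_state mu) s =
  serve q s + unit_state mu *+ ~~ ((s mu == 1) && (q mu == 0)).
Proof.
move=> s1; apply/ffunP => k; rewrite !ffunE.
rewrite unit_state_muln; case: (eqVneq k mu) => [->|_]; last by rewrite mul0n !addr0.
by rewrite mul1n !natrDE; case: (s mu) s1 (q mu) => [|[|//]] _ [|m] /=; lia.
Qed.

Lemma serve_matchingK (q : state) mu : serve (q + matching mu) (matching mu) = q.
Proof. by apply/ffunP => k; rewrite !ffunE addnK. Qed.

(** The Booleans mark the boundary of the state space, where an empty queue has no
job to give back. *)
Lemma serve_matchingD (q : state) mu :
  q = serve q (matching mu) + unit_state mu *+ (0 < q mu)%N
      + unit_state (mate mu) *+ (0 < q (mate mu))%N.
Proof.
apply/ffunP => k; rewrite !ffunE.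
rewrite !unit_state_muln !natrDE.
case: (eqVneq k mu) => [->|_].
  by rewrite neq_mate; lia.
by case: (eqVneq k (mate mu)) => [->|_]; lia.
Qed.

Lemma serveC (q s t : state) : serve (serve q s) t = serve (serve q t) s.
Proof. by apply/ffunP => k; rewrite !ffunE subnAC. Qed.

Lemma matching_cross_compl rho mu kappa : crosses rho mu ->
  matching rho kappa = (1 - matching mu kappa)%N.
Proof.
rewrite !matchingE; move: mu rho kappa => [[[|[|//]] ?] [[|[|//]] ?]]
  [[[|[|//]] ?] [[|[|//]] ?]] [[[|[|//]] ?] [[|[|//]] ?]] //=.
Qed.

Lemma stateDE (p q : state) kappa : (p + q) kappa = (p kappa + q kappa)%N.
Proof. by rewrite ffunE. Qed.

Lemma add_matching_cross (q : state) rho mu : crosses rho mu ->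
  (q + matching mu) rho = q rho.
Proof. by move=> rm; rewrite [LHS]stateDE (matching_cross rm) addn0. Qed.

Lemma serve_crossD (q : state) rho mu : crosses rho mu ->
  serve (q + matching rho) (matching mu) = serve q (matching mu) + matching rho.
Proof.
move=> rm; apply/ffunP => k.
rewrite [LHS]ffunE [RHS]stateDE [X in (X - _)%N]stateDE.
rewrite [X in _ = (X + _)%N]ffunE (matching_cross_compl k rm).
by have := matching_le1 mu k; lia.
Qed.

Lemma conflict_crosses rho mu : conflict rho mu <-> crosses rho mu.
Proof.
have rev2 (x y : 'I_2) : (x == rev_ord y) = (x != y).
  by move: x y => [[|[|//]] ?] [[|[|//]] ?].
rewrite conflictE; case: rho mu => [i j] [k l].
have matesE : ((i, j) == mate (k, l)) = (i != k) && (j != l).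
  by rewrite /mate xpair_eqE !rev2.
rewrite /crosses matesE negb_and !negbK /=.
split=> [[/eqP-> /=]|/andP[/eqP ne]].
  by case=> ->; rewrite eqxx ?orbT.
by case/orP => /eqP e; split=> //; [left|right].
Qed.

(** A schedule that serves a queue outside one matching serves nothing in it, as
each queue of a matching conflicts with both queues of the other. *)
Lemma schedule_le_matching (s : state) rho mu : s \in schedules -> crosses rho mu ->
  (forall k, s k <= matching mu k)%N \/ (forall k, s k <= matching rho k)%N.
Proof.
move=> ss rm; have [/forallP|] := boolP [forall k, s k <= matching mu k]%N; first by left.
rewrite negb_forall => /existsP[k]; rewrite -ltnNge => lt_k; right=> l.
have s1 : forall x, (s x <= 1)%N by move: ss; rewrite mem_schedules => /and3P[/forallP].
rewrite (matching_cross_compl l rm) matchingE.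
have [l_mu|_] := boolP (_ || _); last by rewrite s1.
have k0 : crosses k mu.
  by move: lt_k; rewrite matchingE /crosses -negb_or; case: (_ || _) (s1 k) => //; lia.
have /conflict_crosses[_ /(_ _ ss) no] : crosses k l.
  by case/orP: l_mu => /eqP ->; rewrite ?crosses_mate.
rewrite subnn leqn0; apply/eqP; have := s1 l; have := s1 k; have : s l <> 1 \/ s k <> 1.
  by apply/not_andP => -[sl sk]; apply: no.
by lia.
Qed.

Lemma matching_schedule mu : matching mu \in schedules.
Proof.
rewrite mem_schedules; apply/and3P; split; apply/forallP => x.
- exact: matching_le1.
- rewrite !big_ord_recr big_ord0 /= !matchingE.
  by move: mu x => [[[|[|//]] ?] [[|[|//]] ?]] [[|[|//]] ?].
- rewrite !big_ord_recr big_ord0 /= !matchingE.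
  by move: mu x => [[[|[|//]] ?] [[|[|//]] ?]] [[|[|//]] ?].
Qed.

Lemma crosses_exists mu : exists rho, crosses rho mu.
Proof.
exists (rev_ord mu.1, mu.2).
by case: mu => [[[|[|//]] ?] [[|[|//]] ?]].
Qed.

(** * Monotonicity of action values *)

Section action_values.
Context (R : realType) (c : queue -> R) (beta : R).

(** The invariant of value iteration. The first two clauses make service of more
queues preferable and treat empty queues; the last three make the advantage of a
matching monotone. *)
Record switch_shaped (W : state -> R) : Prop := SwitchShaped {
  shape_ge0 : forall mu q, 0 <= incr W mu q;
  shape_le : forall mu q, incr W mu q <= c mu;
  shape_mate : forall mu q, incr W mu q <= incr W mu (q + unit_state (mate mu));
  shape_cross : forall rho mu q, crosses rho mu ->
    incr W mu (q + unit_state rho) <= incr W mu q;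
  shape_matching : forall rho mu q, crosses rho mu ->
    incr W mu (q + matching mu) <= incr W mu (q + matching rho)
}.

Lemma reward_unit (q s : state) mu : (s mu <= 1)%N ->
  reward c (q + unit_state mu) s =
  reward c q s + ((s mu == 1) && (q mu == 0))%:R * c mu.
Proof.
move=> s1; rewrite /reward (bigD1 mu)//= [in RHS](bigD1 mu)//= !ffunE eqxx.
rewrite [X in _ + X](eq_bigr (fun k => c k * (s k)%:R * (0 < q k)%N%:R)).
  case: (s mu) s1 => [|[|//]] _; first by rewrite !mulr0 !mul0r addr0.
  rewrite natrDE addn1; case: (q mu) => [|m] /=; last by rewrite mul0r addr0.
  by rewrite !mulr1 mulr0 add0r mul1r addrC.
by move=> k /negbTE nk; rewrite !ffunE nk addr0.
Qed.

Section one_step.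
Context (W : state -> R).

(** The value of the action s when W is the mean continuation value. *)
Definition stage_value (s q : state) : R := reward c q s + beta * W (serve q s).

Lemma incr_stage_value (s q : state) mu : (s mu <= 1)%N ->
  incr (stage_value s) mu q =
  if (s mu == 1) && (q mu == 0) then c mu else beta * incr W mu (serve q s).
Proof.
move=> s1; rewrite /incr /stage_value reward_unit// serve_unit//.
by case: ifP => _ /=; rewrite ?mulr0n ?mulr1n ?addr0; ring.
Qed.

Context (beta01 : 0 < beta < 1) (Wshape : switch_shaped W).

Let beta_ge0 : 0 <= beta. Proof. by case/andP: beta01 => /ltW. Qed.
Let scale_le x y : x <= y -> beta * x <= beta * y.
Proof. exact: ler_wpM2l. Qed.
Let incr_le mu q : beta * incr W mu q <= c mu.
Proof.
apply: le_trans (shape_le Wshape mu q); apply: ler_piMl; first exact: shape_ge0.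
by case/andP: beta01 => _ /ltW.
Qed.

Lemma stage_value_incr_bounds (s q : state) mu : (s mu <= 1)%N ->
  0 <= incr (stage_value s) mu q <= c mu.
Proof.
move=> s1; rewrite incr_stage_value//.
have := shape_le Wshape mu q; have W0 := shape_ge0 Wshape mu.
case: ifP => _; first by have := W0 q; lra.
by rewrite incr_le mulr_ge0.
Qed.

(** This extends [shape_matching] to the boundary of the state space. On the
left is the state after serving the matching of rho, on the right that after
serving the matching of mu, and p is the state after serving both; the jobs left
out by the Booleans are those of queues that were empty. *)
Lemma incr_matching_mixed (p : state) rho mu (b x y : bool) : crosses rho mu ->
  incr W mu (p + unit_state mu + unit_state (mate mu) *+ b) <=
  incr W mu (p + unit_state rho *+ x + unit_state (mate rho) *+ y).
Proof.
move=> rm; apply: (@le_trans _ _ (incr W mu (p + matching mu))).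
  rewrite /matching addrA; case: b; rewrite ?mulr1n// mulr0n addr0.
  exact: shape_mate.
apply: (le_trans (shape_matching Wshape p rm)); rewrite /matching addrA.
have mrm : crosses (mate rho) mu by rewrite mate_crosses.
apply: (@le_trans _ _ (incr W mu (p + unit_state rho + unit_state (mate rho) *+ y))).
  by case: y; rewrite ?mulr1n// mulr0n addr0; exact: shape_cross.
case: x; rewrite ?mulr1n// mulr0n addr0 addrAC.
exact: shape_cross.
Qed.

(** The advantage of a matching increases with its own queues. If mu is empty, the
added job brings c mu at once under the matching of mu, which no continuation can
beat; otherwise both states after service lie above a common state p, obtained by
serving both matchings, and [incr_matching_mixed] compares them. *)
Lemma stage_value_cross_le rho mu (q : state) : crosses rho mu ->
  incr (stage_value (matching rho)) mu q <= incr (stage_value (matching mu)) mu q.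
Proof.
move=> rm; rewrite !incr_stage_value ?matching_le1//.
rewrite (@matching_cross mu rho) 1?crossesC//= matchingE eqxx /=.
case: ifPn => [//|q0]; apply: scale_le.
rewrite (serve_matchingD (serve q (matching rho)) mu) serveC.
rewrite [in leRHS](serve_matchingD (serve q (matching mu)) rho).
rewrite [serve q (matching rho) mu]ffunE (@matching_cross mu rho) 1?crossesC//.
by rewrite subn0 lt0n q0 mulr1n; exact: incr_matching_mixed.
Qed.

Lemma stage_value_mate (s : state) mu (q : state) : (forall k, s k <= 1)%N ->
  incr (stage_value s) mu q <= incr (stage_value s) mu (q + unit_state (mate mu)).
Proof.
move=> s1; rewrite !incr_stage_value// !ffunE neq_mate addr0.
case: ifP => // _; apply: scale_le; rewrite serve_unit//.
by case: (~~ _); rewrite ?mulr0n ?mulr1n ?addr0//; exact: shape_mate.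
Qed.

Lemma stage_value_cross (s : state) rho mu (q : state) : (forall k, s k <= 1)%N ->
  crosses rho mu ->
  incr (stage_value s) mu (q + unit_state rho) <= incr (stage_value s) mu q.
Proof.
move=> s1 rm; rewrite !incr_stage_value// !ffunE.
have /andP[/negbTE mr _] : crosses mu rho by rewrite crossesC.
rewrite mr addr0; case: ifP => // _; apply: scale_le; rewrite serve_unit//.
by case: (~~ _); rewrite ?mulr0n ?mulr1n ?addr0//; exact: shape_cross.
Qed.

(** Serving the added matching undoes its addition. *)
Lemma incr_stage_value_self mu (q : state) :
  incr (stage_value (matching mu)) mu (q + matching mu) = beta * incr W mu q.
Proof.
rewrite incr_stage_value ?matching_le1// serve_matchingK.
by rewrite [(q + _) mu]stateDE !matchingE eqxx addn1 andbF.
Qed.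

(** On the left the continuation is from q. On the right it is from q with the
matching of rho in place of the jobs of the matching of mu that were served, so that
[incr_matching_mixed] compares the two. *)
Lemma stage_value_matching_self rho mu (q : state) : crosses rho mu ->
  incr (stage_value (matching mu)) mu (q + matching mu) <=
  incr (stage_value (matching mu)) mu (q + matching rho).
Proof.
move=> rm; rewrite incr_stage_value_self incr_stage_value ?matching_le1//.
case: ifPn => // H.
apply: scale_le; rewrite serve_crossD//.
have q0 : (0 < q mu)%N.
  move: H; rewrite matchingE eqxx /= ffunE (@matching_cross mu rho) 1?crossesC//.
  by rewrite addr0 lt0n.
rewrite [in leLHS](serve_matchingD q mu) q0 mulr1n /matching [in leRHS]addrA.
exact: (incr_matching_mixed _ _ true true).
Qed.

(** The same comparison with the service of the other matching: now the right-hand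
side continues from q. *)
Lemma stage_value_matching_cross rho mu (q : state) : crosses rho mu ->
  incr (stage_value (matching rho)) mu (q + matching mu) <=
  incr (stage_value (matching rho)) mu (q + matching rho).
Proof.
move=> rm; have mr : crosses mu rho by rewrite crossesC.
rewrite !incr_stage_value ?matching_le1// (matching_cross mr) /=.
apply: scale_le; rewrite serve_crossD// serve_matchingK.
rewrite [in leRHS](serve_matchingD q rho) /matching [in leLHS]addrA.
exact: (incr_matching_mixed _ true).
Qed.

Definition advantage rho mu (q : state) : R :=
  stage_value (matching mu) q - stage_value (matching rho) q.

Lemma advantage_addn rho mu (q : state) n : crosses rho mu ->
  advantage rho mu q <= advantage rho mu (q + unit_state mu *+ n).
Proof.
move=> rm; elim: n => [|n IHn]; first by rewrite mulr0n addr0.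
apply: (le_trans IHn); rewrite mulrSr addrA.
have := stage_value_cross_le (q + unit_state mu *+ n) rm.
by rewrite /advantage /incr; lra.
Qed.

(** Two states that compare in opposite ways on the two matchings are linked
through their pointwise minimum, by moves within one matching at a time. *)
Lemma min_state_split (q q' : state) rho :
  (forall k, matching rho k = 0 -> q k <= q' k)%N ->
  q = [ffun k => minn (q k) (q' k)] + unit_state rho *+ (q rho - q' rho)
      + unit_state (mate rho) *+ (q (mate rho) - q' (mate rho)).
Proof.
move=> le; apply/ffunP => k; rewrite 2!stateDE !unit_state_muln ffunE.
have := le k; rewrite matchingE.
case: (eqVneq k rho) => [->|_] /=; first by rewrite neq_mate; lia.
by case: (eqVneq k (mate rho)) => [->|_] /=; lia.
Qed.

(** From q one goes down to the pointwise minimum of q and q' by removing jobs of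
the matching of rho, and from there up to q' by adding jobs of the matching of
mu. Neither move decreases the advantage: for the first, note that exchanging rho
and mu changes its sign. *)
Lemma advantage_le rho mu (q q' : state) : crosses rho mu ->
  (q mu <= q' mu)%N -> (q (mate mu) <= q' (mate mu))%N ->
  (q' rho <= q rho)%N -> (q' (mate rho) <= q (mate rho))%N ->
  advantage rho mu q <= advantage rho mu q'.
Proof.
move=> rm mu1 mu2 rho1 rho2; have mr : crosses mu rho by rewrite crossesC.
have ltc x y : crosses x y ->
    (forall k, matching y k = 0 -> k = x \/ k = mate x).
  move=> xy k; rewrite matchingE => k0.
  by move: (queue_cases k xy) k0 => /or4P[] /eqP->; rewrite ?eqxx ?orbT//; [left|right].
pose m : state := [ffun k => minn (q k) (q' k)].
have /le_trans : advantage rho mu q <= advantage rho mu m.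
  have -> : q = m + unit_state rho *+ (q rho - q' rho)
      + unit_state (mate rho) *+ (q (mate rho) - q' (mate rho)).
    by apply: min_state_split => k /(ltc _ _ mr)[]->.
  have := advantage_addn (m + unit_state rho *+ (q rho - q' rho))
    (q (mate rho) - q' (mate rho)) (etrans (crosses_mate _ _) mr).
  have := advantage_addn m (q rho - q' rho) mr.
  by rewrite /advantage matching_mate; lra.
apply.
have -> : q' = m + unit_state mu *+ (q' mu - q mu)
      + unit_state (mate mu) *+ (q' (mate mu) - q (mate mu)).
  rewrite (_ : m = [ffun k => minn (q' k) (q k)]); last first.
    by apply/ffunP => k; rewrite !ffunE minnC.
  by apply: min_state_split => k /(ltc _ _ rm)[]->.
have := advantage_addn (m + unit_state mu *+ (q' mu - q mu))
  (q' (mate mu) - q (mate mu)) (etrans (crosses_mate _ _) rm).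
have := advantage_addn m (q' mu - q mu) rm.
by rewrite /advantage matching_mate; lra.
Qed.

(** Serving a nonempty queue earns its full reward at once, which is at least the
increment of the discounted continuation value due to keeping the job. *)
Lemma stage_value_add (s q : state) mu : s mu = 0 ->
  stage_value s q <= stage_value (s + unit_state mu) q.
Proof.
move=> s0; rewrite /stage_value.
have -> : reward c q (s + unit_state mu) = reward c q s + c mu * (0 < q mu)%N%:R.
  rewrite /reward (bigD1 mu)//= [in RHS](bigD1 mu)//= !ffunE eqxx s0.
  rewrite [X in _ + X](eq_bigr (fun k => c k * (s k)%:R * (0 < q k)%N%:R)).
    by rewrite add0r mulr0 mul0r add0r mulr1 addrC.
  by move=> k /negbTE nk; rewrite !ffunE nk addr0.
case: (posnP (q mu)) => [q0|q_gt0].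
  rewrite mulr0 addr0 (_ : serve q (_ + _) = serve q s)//.
  apply/ffunP => k; rewrite !ffunE; case: (eqVneq k mu) => [->|_].
    by rewrite q0 !sub0n.
  by rewrite addr0.
have -> : serve q s = serve q (s + unit_state mu) + unit_state mu.
  apply/ffunP => k; rewrite !ffunE; case: (eqVneq k mu) => [->|_].
    by rewrite s0 add0r subn0 natrDE subnK.
  by rewrite !addr0.
have := incr_le mu (serve q (s + unit_state mu)).
by rewrite /incr mulr1; lra.
Qed.

Lemma stage_value_sub_matching (s q : state) mu :
  (forall k, s k <= matching mu k)%N ->
  stage_value s q <= stage_value (matching mu) q.
Proof.
move=> le.
have fill (t : state) kappa : (t kappa <= 1)%N ->
    stage_value t q <= stage_value (t + unit_state kappa *+ (1 - t kappa)) q.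
  case: (t kappa) (@stage_value_add t q kappa) => [|[|//]] add _.
    by rewrite mulr1n; exact: add.
  by rewrite mulr0n addr0.
have le1 k : (s k <= 1)%N := leq_trans (le k) (matching_le1 mu k).
apply: (le_trans (fill s mu (le1 mu))).
set t := s + _.
have tm : t (mate mu) = s (mate mu).
  by rewrite stateDE unit_state_muln mate_neq mul0n addn0.
have -> : matching mu = t + unit_state (mate mu) *+ (1 - t (mate mu)).
  apply/ffunP => k; rewrite matchingE 2!stateDE !unit_state_muln tm.
  have := le k; have := le1 k; rewrite matchingE.
  case: (eqVneq k mu) => [->|_] /=; first by rewrite neq_mate; lia.
  by case: (eqVneq k (mate mu)) => [->|_] /=; lia.
by apply: fill; rewrite tm.
Qed.

(** * Propagation of the invariant *)

(** U is the next value function. In each clause the actions that are optimal at the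
two points of the smaller side are redistributed over the points of the larger
side. *)
Lemma switch_shaped_max (U : state -> R) :
  (forall rho mu, crosses rho mu -> forall q,
    U q = Num.max (stage_value (matching mu) q) (stage_value (matching rho) q)) ->
  switch_shaped U.
Proof.
move=> Umax.
have Uge mu q : stage_value (matching mu) q <= U q.
  have [rho rm] := crosses_exists mu.
  by rewrite (Umax _ _ rm) le_max lexx.
have Ucase rho mu q : crosses rho mu ->
    U q = stage_value (matching mu) q \/ U q = stage_value (matching rho) q.
  by move=> rm; rewrite (Umax _ _ rm); case: leP => _; [right|left].
have mono s mu q := stage_value_incr_bounds q (matching_le1 s mu).
split.
- move=> mu q; have [rho rm] := crosses_exists mu; rewrite /incr.
  have := mono mu mu q; have := mono rho mu q.
  have := Uge mu (q + unit_state mu); have := Uge rho (q + unit_state mu).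
  by rewrite /incr; case: (Ucase rho mu q rm) => ->; lra.
- move=> mu q; have [rho rm] := crosses_exists mu; rewrite /incr.
  have := mono mu mu q; have := mono rho mu q.
  have := Uge mu q; have := Uge rho q.
  by rewrite /incr; case: (Ucase rho mu (q + unit_state mu) rm) => ->; lra.
- move=> mu q; have [rho rm] := crosses_exists mu.
  have rm' : crosses rho (mate mu) by rewrite crosses_mate.
  have := stage_value_mate mu q (matching_le1 mu).
  have := stage_value_mate mu q (matching_le1 rho).
  have := stage_value_cross_le q rm.
  have := stage_value_cross_le q rm'.
  have := Uge mu (q + unit_state (mate mu) + unit_state mu).
  have := Uge rho (q + unit_state (mate mu) + unit_state mu).
  have := Uge mu q; have := Uge rho q.
  rewrite matching_mate /incr.
  by case: (Ucase rho mu (q + unit_state mu) rm) => ->;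
    case: (Ucase rho mu (q + unit_state (mate mu)) rm) => ->; lra.
- move=> rho mu q rm; have mr : crosses mu rho by rewrite crossesC.
  have := stage_value_cross q (matching_le1 mu) rm.
  have := stage_value_cross q (matching_le1 rho) rm.
  have := stage_value_cross_le q rm.
  have := stage_value_cross_le q mr.
  have := Uge mu (q + unit_state mu); have := Uge rho (q + unit_state mu).
  have := Uge mu (q + unit_state rho); have := Uge rho (q + unit_state rho).
  rewrite /incr.
  by case: (Ucase rho mu (q + unit_state rho + unit_state mu) rm) => ->;
    case: (Ucase rho mu q rm) => ->; lra.
- move=> rho mu q rm; have mr : crosses mu rho by rewrite crossesC.
  have := stage_value_matching_self q rm.
  have := stage_value_matching_cross q rm.
  (* If the matching of rho is used at q + matching rho, and that of mu at
     q + matching mu + unit_state mu, both continue from q. *)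
  have E : incr (stage_value (matching rho)) mu (q + matching rho) =
           incr (stage_value (matching mu)) mu (q + matching mu).
    rewrite incr_stage_value_self incr_stage_value ?matching_le1//.
    by rewrite (matching_cross mr) /= serve_matchingK.
  (* This excludes the opposite choice of actions, up to ties. *)
  have D : advantage rho mu (q + matching rho) <=
           advantage rho mu (q + matching mu + unit_state mu).
    have /andP[/negbTE rm1 _] := rm.
    have mrm : crosses (mate rho) mu by rewrite mate_crosses.
    have mmr : crosses (mate mu) rho by rewrite mate_crosses.
    have /andP[/negbTE mrm1 _] := mrm.
    apply: advantage_le => //.
    - by rewrite add_matching_cross// -addrA stateDE leq_addr.
    - by rewrite add_matching_cross// -addrA stateDE leq_addr.
    - by rewrite [leqLHS]stateDE add_matching_cross// ffunE rm1 addn0 stateDE leq_addr.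
    - by rewrite [leqLHS]stateDE add_matching_cross// ffunE mrm1 addn0 stateDE leq_addr.
  move: E D.
  have := Uge mu (q + matching mu); have := Uge rho (q + matching mu).
  have := Uge mu (q + matching rho + unit_state mu).
  have := Uge rho (q + matching rho + unit_state mu).
  rewrite /advantage /incr.
  by case: (Ucase rho mu (q + matching mu + unit_state mu) rm) => ->;
    case: (Ucase rho mu (q + matching rho) rm) => ->; lra.
Qed.
End one_step.
End action_values.

(** * Value iteration *)

Section value_iteration.
Context d (T : measurableType d) (R : realType) (P : probability T R).
Context (A : queue -> {RV P >-> nat}) (c : queue -> R) (beta : R).
Context (c_ge0 : forall rho, 0 <= c rho) (beta01 : 0 < beta < 1).

Lemma switch_shaped_mean (V : state -> R) : bounded_fn V ->
  switch_shaped c V -> switch_shaped c (mean A V).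
Proof.
move=> bV [V0 Vc Vmate Vcross Vmatching].
have b mu := bounded_fn_incr mu bV.
have bk (k : R) : bounded_fn (fun=> k) by exists `|k|.
split=> [mu q|mu q|mu q|rho mu q rm|rho mu q rm]; rewrite !incr_mean//.
- rewrite -[leLHS](mean_cst A 0 q); exact: mean_le.
- rewrite -[leRHS](mean_cst A (c mu) q); exact: mean_le.
- by apply: mean_le => // x; rewrite addrAC; exact: Vmate.
- by apply: mean_le => // x; rewrite addrAC; exact: Vcross.
- by apply: mean_le => // x; rewrite ![q + _ + x]addrAC; exact: Vmatching.
Qed.

(** Only the two matchings matter, since every schedule is below one of them. *)
Lemma optimal_valueE (V : state -> R) rho mu q : bounded_fn V ->
  switch_shaped c V -> crosses rho mu ->
  optimal_value A c beta V q =
  Num.max (stage_value c beta (mean A V) (matching mu) q)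
          (stage_value c beta (mean A V) (matching rho) q).
Proof.
move=> bV Vs rm; have Ws := switch_shaped_mean bV Vs.
have ub s : s \in schedules -> action_value A c beta V q s <=
    Num.max (stage_value c beta (mean A V) (matching mu) q)
            (stage_value c beta (mean A V) (matching rho) q).
  move=> ss; rewrite le_max; apply/orP.
  by have [le|le] := schedule_le_matching ss rm; [left|right];
    apply: stage_value_sub_matching.
have lb kappa : action_value A c beta V q (matching kappa) <=
    optimal_value A c beta V q.
  rewrite /optimal_value.
  exact: (le_bigmax_seq _ _ xpredT _ (matching_schedule kappa)).
apply/le_anti/andP; split; last by rewrite ge_max !lb.
rewrite /optimal_value big_seq; apply: bigmax_le => [|s]; last exact: ub.
rewrite le_max; apply/orP; left.
by apply: stage_value_sub_matching => // k; rewrite ffunE.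
Qed.

Lemma bounded_fn_stage_value (W : state -> R) (s : state) : bounded_fn W ->
  bounded_fn (stage_value c beta W s).
Proof.
move=> [M WM]; exists (\sum_rho `|c rho * (s rho)%:R| + `|beta| * M) => q.
rewrite (le_trans (ler_normD _ _))// lerD//; last by rewrite normrM ler_wpM2l.
rewrite (le_trans (ler_norm_sum _ _ _))// ler_sum// => rho _.
by rewrite [leLHS]normrM; case: (0 < q rho)%N; rewrite ?normr1 ?mulr1// normr0 mulr0.
Qed.

Lemma value_shape n : bounded_fn (value A c beta n) /\ switch_shaped c (value A c beta n).
Proof.
elim: n => [|n [bV Vs]] /=.
  split; first by exists 0 => q; rewrite normr0.
  by split=> *; rewrite /incr subrr.
split; last first.
  apply: (@switch_shaped_max _ _ beta (mean A (value A c beta n))) => //.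
    exact: switch_shaped_mean.
  by move=> rho mu rm q; exact: optimal_valueE.
have [rho rm] := crosses_exists (ord0, ord0).
have bW := bounded_fn_mean A bV.
have [M1 H1] := bounded_fn_stage_value (matching (ord0, ord0)) bW.
have [M2 H2] := bounded_fn_stage_value (matching rho) bW.
exists (Num.max M1 M2) => q; rewrite (optimal_valueE q bV Vs rm) le_max.
by rewrite maxEle; case: ifP => _; rewrite ?H1 ?H2 ?orbT.
Qed.

Lemma optimal_actionE rho mu n q : crosses rho mu ->
  optimal_action A c beta n q (matching mu) <->
  0 <= advantage c beta (mean A (value A c beta n)) rho mu q.
Proof.
move=> rm; have [bV Vs] := value_shape n.
rewrite /optimal_action (optimal_valueE q bV Vs rm) matching_schedule /advantage.
rewrite subr_ge0 /action_value -/(mean A _ _) -/(stage_value _ _ _ _ _).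
split=> [[_ ->]|]; first by rewrite le_max lexx orbT.
by move=> le; rewrite max_l.
Qed.
End value_iteration.

Theorem theorem4 (d : measure_display) (T : measurableType d) (R : realType)
    (P : probability T R) (A : queue -> {RV P >-> nat})
    (c : queue -> R) (beta : R) :
  mutually_independent A ->
  (forall j : 'I_2, (\sum_(i < 2) arrival_mean A (i, j) < 1)%E) ->
  (forall i : 'I_2, (\sum_(j < 2) arrival_mean A (i, j) < 1)%E) ->
  (forall rho : queue, 0 <= c rho) ->
  0 < beta < 1 ->
  forall (q : state) (mu nu : queue),
  mu <> nu ->
  unit_state mu + unit_state nu \in schedules ->
  forall n : nat,
  optimal_action A c beta n q (unit_state mu + unit_state nu) ->
  [/\ optimal_action A c beta n (q + unit_state mu)
        (unit_state mu + unit_state nu),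
      optimal_action A c beta n (q + unit_state nu)
        (unit_state mu + unit_state nu) &
      forall q' : state,
        (q mu <= q' mu)%N -> (q nu <= q' nu)%N ->
        (forall rho : queue, conflict rho mu -> q' rho = q rho) ->
        optimal_action A c beta n q' (unit_state mu + unit_state nu)].
Proof.
move=> _ _ _ c_ge0 beta01 q mu nu mu_nu sched n opt.
(* Two distinct queues of a schedule do not conflict. *)
have nuE : nu = mate mu.
  apply: contrapT => /eqP nm.
  have /conflict_crosses[_ /(_ _ sched)] : crosses nu mu.
    by rewrite /crosses nm andbT; apply/eqP => e; apply: mu_nu.
  have ne : (mu == nu) = false by apply/eqP.
  by apply; rewrite !ffunE !eqxx ne eq_sym ne.
rewrite {}nuE {nu mu_nu sched} in opt *.
have mono (q' : state) : (q mu <= q' mu)%N -> (q (mate mu) <= q' (mate mu))%N ->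
    (forall rho, conflict rho mu -> q' rho = q rho) ->
    optimal_action A c beta n q' (matching mu).
  move=> le1 le2 eqc; have [rho rm] := crosses_exists mu.
  have [bV Vs] := value_shape A c_ge0 beta01 n.
  apply/(optimal_actionE _ c_ge0 beta01 _ _ rm).
  move/(optimal_actionE _ c_ge0 beta01 _ _ rm): opt => /le_trans; apply.
  apply: advantage_le => //; first exact: switch_shaped_mean.
    by rewrite eqc//; apply/conflict_crosses.
  by rewrite eqc//; apply/conflict_crosses; rewrite mate_crosses.
have off kappa rho : kappa = mu \/ kappa = mate mu -> conflict rho mu ->
    (q + unit_state kappa) rho = q rho.
  move=> k /conflict_crosses/andP[/negbTE r1 /negbTE r2]; rewrite !ffunE.
  by case: k => ->; rewrite ?r1 ?r2 addr0.
split; last exact: mono.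
- apply: mono; [| |by move=> rho; apply: off; left]; rewrite ffunE; exact: leq_addr.
- apply: mono; [| |by move=> rho; apply: off; right]; rewrite ffunE; exact: leq_addr.
Qed.
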